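(* Let $B=(V,E)$ be a generalized Bratteli diagram, $q^{(0)}$ a positive vector on $V_0$, $(P_n)_{n\ge0}$ a sequence of Markov matrices on $B$, and let $q^{(n)}$, the dual kernels $Q_n$, the Hilbert spaces $\mathcal H_n$ and the operators $T_{P_n},T_{Q_n}$ be defined as in the context. (1) The operators $T_{P_n}:\mathcal H_{n+1}\to\mathcal H_n$ and $T_{Q_n}:\mathcal H_n\to\mathcal H_{n+1}$ are positive and contractive for all $n\ge 0$. (2) $(T_{P_n})^*=T_{Q_n}$ and $(T_{Q_n})^*=T_{P_n}$ for all $n\ge 0$.
   Context: A generalized Bratteli diagram $B=(V,E)$ is a graded graph with $V=\bigsqcup_{n\ge0}V_n$, each $V_n$ being a copy of a fixed countably infinite set $V_0$, and $E=\bigsqcup_{n\ge 0}E_n$, where $E_n$ is the set of edges between $V_n$ and $V_{n+1}$. Each $e\in E_n$ has a source $s(e)\in V_n$ and a range $r(e)\in V_{n+1}$. For $w\in V_n$, $v\in V_{n+1}$ the set $E(w,v)$ of edges with source $w$ and range $v$ is finite (possibly empty). The incidence matrix $F_n=(|E(w,v)|: v\in V_{n+1}, w\in V_n)$ has only finitely many non-zero entries in each row and has no zero row and no zero column. A sequence of Markov matrices on $B$ is a sequence $P_n=(p^{(n)}_{v,e}: v\in V_n, e\in E_n)$ of non-negative matrices with $p^{(n)}_{v,e}>0\iff s(e)=v$, and $\sum_{e:\,s(e)=v}p^{(n)}_{v,e}=1$ for all $v\in V_n$. Put $\widehat p_n(v,u)=\sum_{e\in E(v,u)}p^{(n)}_{v,e}$,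 $q^{(n+1)}_u=\sum_{v\in V_n}q^{(n)}_v\widehat p_n(v,u)$ and $\widehat q_n(u,v)=\frac{q^{(n)}_v}{q^{(n+1)}_u}\widehat p_n(v,u)$ for $v\in V_n,u\in V_{n+1}$. The dual kernel $Q_n$ has edge entries $q^{(n)}_{u,e}$ ($r(e)=u$) with $\sum_{e\in E(v,u)}q^{(n)}_{u,e}=\widehat q_n(u,v)$. $\mathcal H_n$ is the real Hilbert space of functions $f$ on $V_n$ with $\|f\|^2_{\mathcal H_n}=\sum_{v\in V_n}q^{(n)}_vf(v)^2<\infty$ and inner product $\langle\varphi,\psi\rangle_{\mathcal H_n}=\sum_{v\in V_n}\varphi(v)\psi(v)q^{(n)}_v$. The operators are $$(T_{P_n}f)(v)=\sum_{e:\,s(e)=v}p^{(n)}_{v,e}f(r(e))=\sum_{u\in V_{n+1}}\widehat p_n(v,u)f(u),\quad v\in V_n,$$ $$(T_{Q_n}g)(u)=\sum_{e:\,r(e)=u}q^{(n)}_{u,e}g(s(e))=\sum_{v\in V_n}\widehat q_n(u,v)g(v),\quad u\in V_{n+1}.$$ Positive means mapping non-negative functions to non-negative functions. *)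

(* Defs.v *)
From HB Require Import structures.
From mathcomp Require Import all_boot all_order all_algebra finmap.
From mathcomp Require Import mathcomp_extra boolp classical_sets functions.
From mathcomp Require Import cardinality fsbigop reals ereal.
From mathcomp Require Import numfun esum.
Set Implicit Arguments.
Unset Strict Implicit.
Unset Printing Implicit Defensive.
Import Order.TTheory GRing.Theory Num.Theory.
Local Open Scope classical_set_scope.
Local Open Scope ring_scope.

(* [edge n] is the set of edges between levels [n] and [n.+1]. *)
Record graded_graph := GradedGraph {
  vtx0 : countType;
  edge : nat -> choiceType;
  edge_src : forall n, edge n -> vtx0;
  edge_rng : forall n, edge n -> vtx0
}.

Definition vtx (B : graded_graph) (n : nat) : countType := vtx0 B.
Definition src (B : graded_graph) n (e : edge B n) : vtx B n := edge_src e.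
Definition rng (B : graded_graph) n (e : edge B n) : vtx B n.+1 := edge_rng e.

Definition edges (B : graded_graph) n (w : vtx B n) (v : vtx B n.+1)
  : set (edge B n) := [set e | src e = w /\ rng e = v].

(* [fset_set A] is empty when [A] is infinite; the cardinality is meaningful
   because of [finite_edges] below. *)
Definition incidence (B : graded_graph) n (v : vtx B n.+1) (w : vtx B n) : nat :=
  #|` fset_set (edges w v)|%fset.

Record generalized_Bratteli (B : graded_graph) : Prop := {
  infinite_level : infinite_set [set: vtx0 B];
  finite_edges : forall n (w : vtx B n) (v : vtx B n.+1),
    finite_set (edges w v);
  finite_rows : forall n (v : vtx B n.+1),
    finite_set [set w : vtx B n | incidence v w != 0%N];
  nonzero_row : forall n (v : vtx B n.+1),
    exists w : vtx B n, incidence v w != 0%N;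
  nonzero_column : forall n (w : vtx B n),
    exists v : vtx B n.+1, incidence v w != 0%N
}.

(* Unconditional sum of a real family: meaningful when the family is
   [summable] (and then it is the limit of the finite partial sums). *)
Definition rsum (R : realType) (T : choiceType) (A : set T) (f : T -> R) : R :=
  (fine (\esum_(i in A) ((EFin \o f)^\+%E i))
   - fine (\esum_(i in A) ((EFin \o f)^\-%E i)))%R.

Section kernels.
Variables (R : realType) (B : graded_graph).

Record Markov (P : forall n, vtx B n -> edge B n -> R) : Prop := {
  Markov_ge0 : forall n (v : vtx B n) (e : edge B n), 0 <= P n v e;
  Markov_gt0 : forall n (v : vtx B n) (e : edge B n),
    0 < P n v e <-> src e = v;
  Markov_sum1 : forall n (v : vtx B n),
    \esum_(e in [set e : edge B n | src e = v]) (P n v e)%:E = 1%E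
}.

Variable P : forall n, vtx B n -> edge B n -> R.

Definition phat n (v : vtx B n) (u : vtx B n.+1) : R :=
  \sum_(e \in edges v u) P v e.

(* The sum has finite support because the incidence matrices have finite rows. *)
Fixpoint qvec (q0 : vtx B 0 -> R) (n : nat) : vtx B n -> R :=
  match n return vtx B n -> R with
  | 0 => q0
  | m.+1 => fun u => \sum_(v \in [set: vtx B m]) (qvec q0 v * phat v u)
  end.

Definition qhat (q0 : vtx B 0 -> R) n (u : vtx B n.+1) (v : vtx B n) : R :=
  qvec q0 v / qvec q0 u * phat v u.

(* The dual kernel is specified only through its sums over the sets of parallel
   edges; only the entries [Q n u e] with [rng e = u] are ever used. *)
Definition dual_kernel (q0 : vtx B 0 -> R)
    (Q : forall n, vtx B n.+1 -> edge B n -> R) : Prop :=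
  forall n (u : vtx B n.+1) (v : vtx B n),
    \sum_(e \in edges v u) Q n u e = qhat q0 u v.

(* The edges with a given source may be infinitely many. *)
Definition TP n (f : vtx B n.+1 -> R) : vtx B n -> R :=
  fun v => rsum [set e : edge B n | src e = v] (fun e => P v e * f (rng e)).

Definition TP_converges n (f : vtx B n.+1 -> R) : Prop :=
  forall v : vtx B n, summable [set e : edge B n | src e = v]
    (fun e => (P v e * f (rng e))%:E).

(* The edges with a given range are finitely many. *)
Definition TQ (Q : forall n, vtx B n.+1 -> edge B n -> R)
    n (g : vtx B n -> R) : vtx B n.+1 -> R :=
  fun u => \sum_(e \in [set e : edge B n | rng e = u]) (Q n u e * g (src e)).

End kernels.

Section weighted_l2.
Variable R : realType.

Definition Hsp (V : choiceType) (q : V -> R) : set (V -> R) :=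
  [set f | (\esum_(v in [set: V]) (q v * f v ^+ 2)%:E < +oo)%E].

Definition Hinner (V : choiceType) (q : V -> R) (f g : V -> R) : R :=
  rsum [set: V] (fun v => f v * g v * q v).

Definition Hnorm (V : choiceType) (q : V -> R) (f : V -> R) : R :=
  Num.sqrt (fine (\esum_(v in [set: V]) (q v * f v ^+ 2)%:E)).

Variables (V W : choiceType) (q : V -> R) (r : W -> R).

Definition linear_op (T : (V -> R) -> (W -> R)) : Prop :=
  (forall f, Hsp q f -> Hsp r (T f)) /\
  (forall (a : R) f g, Hsp q f -> Hsp q g ->
     T (fun v => a * f v + g v) = (fun w => a * T f w + T g w)).

Definition positive_op (T : (V -> R) -> (W -> R)) : Prop :=
  forall f, Hsp q f -> (forall v, 0 <= f v) -> forall w, 0 <= T f w.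

Definition contractive_op (T : (V -> R) -> (W -> R)) : Prop :=
  forall f, Hsp q f -> Hnorm r (T f) <= Hnorm q f.

(* [T^* = S] : for every [g] in the target space of [T], [S g] is the unique
   [h] in its domain space representing the functional [f |-> <T f, g>]. *)
Definition is_adjoint (T : (V -> R) -> (W -> R)) (S : (W -> R) -> (V -> R)) :
    Prop :=
  forall g, Hsp r g -> forall h,
    (Hsp q h /\ forall f, Hsp q f -> Hinner r (T f) g = Hinner q f h)
    <-> h = S g.

End weighted_l2.

(* Main.v *)
(** The weights [m e = q_(s e) p_(s e, e)] define a measure on the edges between
    levels [n] and [n.+1], whose images under source and range are [q^(n)] and
    [q^(n+1)].  Hence [f |-> f o r] and [g |-> g o s] embed the two Hilbert
    spaces isometrically into L^2(m), and [T_P], [T_Q] are these embeddings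
    followed by the conditional expectation on the source, respectively on the
    range.  Conditional expectations are positive and contractive, and both
    [<T_P f, g>] and [<f, T_Q g>] are equal to the sum of
    [m e * f (r e) * g (s e)] over all edges. *)
Require Import Defs.
From HB Require Import structures.
From mathcomp Require Import all_boot all_order all_algebra finmap.
From mathcomp Require Import mathcomp_extra boolp classical_sets functions.
From mathcomp Require Import cardinality fsbigop reals ereal.
From mathcomp Require Import numfun esum.
From mathcomp Require Import ring lra.
Set Implicit Arguments.
Unset Strict Implicit.
Unset Printing Implicit Defensive.
Import Order.TTheory GRing.Theory Num.Theory.
Local Open Scope classical_set_scope.
Local Open Scope ring_scope.

(** * Sums of non-negative families in the extended reals *)

Lemma esumZ (R : realType) (T : choiceType) (D : set T) (c : R) (f : T -> R) :
  0 <= c -> (forall i, 0 <= f i) ->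
  (\esum_(i in D) (c * f i)%:E = c%:E * \esum_(i in D) (f i)%:E)%E.
Proof.
have le (k : R) (g : T -> R) : 0 <= k -> (forall i, 0 <= g i) ->
    (\esum_(i in D) (k * g i)%:E <= k%:E * \esum_(i in D) (g i)%:E)%E.
  move=> k0 g0; apply: ge_ereal_sup => _ [X [finX XD] <-].
  rewrite fsbig_finite//=.
  under eq_bigr do rewrite EFinM.
  rewrite -ge0_sume_distrr//; last by move=> i _; rewrite lee_fin.
  rewrite lee_wpmul2l ?lee_fin//; apply: esum_ge; exists X => //.
  by rewrite fsbig_finite.
(* For [c = 0] the sum of [f] may be infinite; the convention [0 * +oo = 0] makes both sides
   vanish. *)
rewrite le_eqVlt => /predU1P[<- f0|c0 f0].
  by rewrite mul0e esum1// => i _; rewrite mul0r.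
apply/eqP; rewrite eq_le le ?(ltW c0)//=.
(* The reverse inequality is [le] for the factor [c^-1] and the family [c * f]. *)
have cV0 : 0 <= c^-1 by rewrite invr_ge0 ltW.
have /= := le _ (fun i => c * f i) cV0 (fun i => mulr_ge0 (ltW c0) (f0 i)).
under eq_esum do rewrite mulKf ?gt_eqF//.
have cE0 : (0 <= c%:E)%E by rewrite lee_fin ltW.
move=> /(lee_wpmul2l cE0) /le_trans; apply.
by rewrite muleA -EFinM divff ?gt_eqF// mul1e.
Qed.

Lemma esum_supp1 (R : realType) (T : choiceType) (w : T) (a : T -> \bar R) :
  (0 <= a w)%E -> (forall i, i <> w -> a i = 0%E) ->
  \esum_(i in [set: T]) a i = a w.
Proof.
move=> aw a0; rewrite -[RHS](esum_set1 aw) [RHS]esum_mkcond.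
by apply: eq_esum => i _; case: ifPn => // /negP; rewrite inE => /a0.
Qed.

(** Tonelli: the iterated sum runs over the pairs [(v, e)] with [s e = v], and [e |-> (s e, e)] is a
    bijection from [E] onto these pairs. *)
Lemma esum_fiber (R : realType) (E V : choiceType) (s : E -> V)
    (a : E -> \bar R) : (forall e, 0 <= a e)%E ->
  \esum_(e in [set: E]) a e =
  \esum_(v in [set: V]) \esum_(e in [set e | s e = v]) a e.
Proof.
move=> a0; rewrite esum_esum//.
rewrite (reindex_esum [set: E] _ (fun e => (s e, e)))//; split => //=.
- by move=> e e' _ _ [].
- by move=> [v e] [_ /= <-]; exists e.
Qed.

(** * Signed unconditional sums *)

Lemma max0_subN (R : realDomainType) (x : R) :
  Num.max x 0 - Num.max (- x) 0 = x.
Proof. by case: (leP x 0) => x0; case: leP => ?; lra. Qed.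

Lemma max0_ge0 (R : realDomainType) (x : R) : 0 <= Num.max x 0.
Proof. by rewrite le_max lexx orbT. Qed.

Section rsum.
Variables (R : realType) (T : choiceType).
Implicit Types (D : set T) (f g h : T -> R) (c : R).

Lemma summable_ge0 D f : (forall i, D i -> 0 <= f i) ->
  summable D (EFin \o f) = (\esum_(i in D) (f i)%:E < +oo)%E.
Proof.
move=> f0; rewrite /summable; congr (_ < _)%E; apply: eq_esum => i Di /=.
by rewrite ger0_norm// f0.
Qed.

Lemma esum_lty_fin_num D f : (forall i, D i -> 0 <= f i) ->
  (\esum_(i in D) (f i)%:E < +oo)%E -> \esum_(i in D) (f i)%:E \is a fin_num.
Proof.
by move=> f0; rewrite ge0_fin_numE//; apply: esum_ge0 => i /f0; rewrite lee_fin.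
Qed.

Lemma summable_le D f g : (forall i, D i -> `|f i| <= g i) ->
  (\esum_(i in D) (g i)%:E < +oo)%E -> summable D (EFin \o f).
Proof.
by move=> fg; apply: le_lt_trans; apply: le_esum => i /fg /=; rewrite lee_fin.
Qed.

Lemma eq_rsum D f g : (forall i, D i -> f i = g i) -> rsum D f = rsum D g.
Proof.
by move=> fg; congr (fine _ - fine _); apply: eq_esum => i Di;
  rewrite ?funeposE ?funenegE /= fg.
Qed.

Lemma rsumE D f : rsum D f = fine (\esum_(i in D) (Num.max (f i) 0)%:E)
  - fine (\esum_(i in D) (Num.max (- f i) 0)%:E).
Proof.
by congr (fine _ - fine _); apply: eq_esum => i _;
  rewrite ?funeposE ?funenegE /= EFin_max.
Qed.

Lemma rsum_ge0E D f : (forall i, D i -> 0 <= f i) ->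
  rsum D f = fine (\esum_(i in D) (f i)%:E).
Proof.
move=> f0; rewrite rsumE [X in _ - fine X]esum1/= ?subr0.
  by congr fine; apply: eq_esum => i Di; rewrite max_l ?f0.
by move=> i Di; rewrite max_r// oppr_le0 f0.
Qed.

Lemma rsum_ge0 D f : (forall i, D i -> 0 <= f i) -> 0 <= rsum D f.
Proof.
move=> f0; rewrite rsum_ge0E//; apply/fine_ge0/esum_ge0 => i /f0.
by rewrite lee_fin.
Qed.

Lemma rsumN D f : rsum D (fun i => - f i) = - rsum D f.
Proof.
by rewrite !rsumE opprB; under [in X in _ - fine X]eq_esum do rewrite opprK.
Qed.

(** This holds without summability: for [c > 0] an infinite part stays infinite after scaling, and
    [fine] sends it to 0 on both sides. [TP_condE] relies on this to treat arbitrary [f]. *)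
Lemma rsumZ D c f : rsum D (fun i => c * f i) = c * rsum D f.
Proof.
wlog c0 : c / 0 <= c => [wl|].
  have [/wl//|/ltW c0] := leP 0 c.
  apply: oppr_inj; rewrite -rsumN -mulNr -wl ?oppr_ge0//.
  by apply: eq_rsum => i _; rewrite mulNr.
have Z (g : T -> R) : fine (\esum_(i in D) (Num.max (c * g i) 0)%:E) =
    c * fine (\esum_(i in D) (Num.max (g i) 0)%:E).
  under eq_esum do rewrite -[0](mulr0 c) -maxr_pMr//.
  rewrite esumZ// => [|i]; last exact: max0_ge0.
  have : (0 <= \esum_(i in D) (Num.max (g i) 0)%:E)%E.
    by apply: esum_ge0 => i _; rewrite lee_fin max0_ge0.
  move: c0; rewrite le_eqVlt => /predU1P[<-|c0]; first by rewrite mul0e mul0r.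
  by case: esum => //= _; rewrite gt0_muley ?mulr0.
rewrite !rsumE mulrBr -(Z f) -(Z (fun i => - f i)); congr (_ - fine _).
by apply: eq_esum => i _; rewrite mulrN.
Qed.

(** Here [g] and [h] may exceed the positive and negative parts of [g - h]. By [esumB] the common
    excess cancels in the extended reals; since all four sums are finite, the identity passes to the
    reals. *)
Lemma rsumB_ge0 D g h :
  (forall i, D i -> 0 <= g i) -> (forall i, D i -> 0 <= h i) ->
  (\esum_(i in D) (g i)%:E < +oo)%E -> (\esum_(i in D) (h i)%:E < +oo)%E ->
  rsum D (fun i => g i - h i) =
  fine (\esum_(i in D) (g i)%:E) - fine (\esum_(i in D) (h i)%:E).
Proof.
move=> g0 h0 gfin hfin.
have Sg : summable D (EFin \o g) by rewrite summable_ge0.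
have Sh : summable D (EFin \o h) by rewrite summable_ge0.
have := esumB Sg Sh g0 h0.
set F := ((EFin \o g) \- (EFin \o h))%E.
have SF : summable D F := summableB Sg Sh.
have finp : \esum_(i in D) (F^\+ i)%E \is a fin_num.
  have := summable_funepos SF; rewrite summableE.
  by under eq_esum do rewrite gee0_abs//.
have finn : \esum_(i in D) (F^\- i)%E \is a fin_num.
  have := summable_funeneg SF; rewrite summableE.
  by under eq_esum do rewrite gee0_abs//.
rewrite /rsum -[EFin \o (fun i => g i - h i)]/F -!fineB// ?esum_lty_fin_num//.
by move=> ->.
Qed.

Lemma summable_max D f : summable D (EFin \o f) ->
  (\esum_(i in D) (Num.max (f i) 0)%:E < +oo)%E /\
  (\esum_(i in D) (Num.max (- f i) 0)%:E < +oo)%E.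
Proof.
by move=> Sf; split; apply: le_lt_trans Sf; apply: le_esum => i _ /=;
  rewrite lee_fin ge_max normr_ge0 andbT ?ler_norm// -normrN ler_norm.
Qed.

Lemma rsumD D f g : summable D (EFin \o f) -> summable D (EFin \o g) ->
  rsum D (fun i => f i + g i) = rsum D f + rsum D g.
Proof.
move=> /summable_max[fp fn] /summable_max[gp gn].
have p0 (u : T -> R) i : 0 <= Num.max (u i) 0 by exact: max0_ge0.
(* The positive part of a sum is not the sum of the positive parts, so [f + g] is written as another
   difference of non-negative summable families, which suffices for [rsumB_ge0]. *)
rewrite (@eq_rsum _ _ (fun i => (Num.max (f i) 0 + Num.max (g i) 0)
    - (Num.max (- f i) 0 + Num.max (- g i) 0))); last first.
  by move=> i _; rewrite opprD addrACA !max0_subN.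
have D' (u v : T -> R) : (\esum_(i in D) (Num.max (u i) 0 + Num.max (v i) 0)%:E =
    \esum_(i in D) (Num.max (u i) 0)%:E + \esum_(i in D) (Num.max (v i) 0)%:E)%E.
  by rewrite -esumD// => i _; rewrite lee_fin max0_ge0.
rewrite rsumB_ge0 ?D' ?lte_add_pinfty//;
  try by move=> *; rewrite addr_ge0 ?max0_ge0.
rewrite !fineD ?esum_lty_fin_num//; try by move=> *; rewrite max0_ge0.
rewrite !rsumE; ring.
Qed.

Lemma summableZ D c f : summable D (EFin \o f) ->
  summable D (EFin \o (fun i => c * f i)).
Proof.
rewrite /summable /=; under [in X in _ -> X]eq_esum do rewrite normrM.
by rewrite esumZ// => fin; rewrite lte_mul_pinfty// ?lee_fin.
Qed.

Lemma sub_summable D D' f : D `<=` D' -> summable D' (EFin \o f) ->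
  summable D (EFin \o f).
Proof.
move=> DD'; apply: le_lt_trans; rewrite esum_mkcond [leRHS]esum_mkcond.
apply: le_esum => i _; case: ifPn => [/[!inE] /DD' Di|_].
  by rewrite ifT// inE.
by case: ifP.
Qed.

Lemma rsum_supp1 (w : T) f : (forall i, i <> w -> f i = 0) ->
  rsum [set: T] f = f w.
Proof.
move=> f0; rewrite rsumE !(@esum_supp1 _ _ w)/= ?lee_fin ?max0_ge0 ?max0_subN//.
- by move=> i /f0 ->; rewrite oppr0 maxxx.
- by move=> i /f0 ->; rewrite maxxx.
Qed.

Lemma rsum_finite D f : finite_set D -> rsum D f = \sum_(i \in D) f i.
Proof.
move=> finD; rewrite rsumE.
have F (g : T -> R) : fine (\esum_(i in D) (Num.max (g i) 0)%:E) =
    \sum_(i <- fset_set D) Num.max (g i) 0.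
  rewrite esum_fset//; last by move=> i _; rewrite lee_fin max0_ge0.
  by rewrite fsbig_finite//= sumEFin.
rewrite !F fsbig_finite// -sumrB.
by apply: eq_bigr => i _; rewrite max0_subN.
Qed.

End rsum.

(** Fubini, from [esum_fiber] applied to the positive and negative parts of [f]. Their fiber sums
    need not be the parts of the fiber sums of [f], whence the use of [rsumB_ge0]. *)
Lemma rsum_fiber (R : realType) (E V : choiceType) (s : E -> V) (f : E -> R) :
  summable [set: E] (EFin \o f) ->
  rsum [set: E] f = rsum [set: V] (fun v => rsum [set e | s e = v] f).
Proof.
move=> Sf; have [fp fn] := summable_max Sf.
have max0 (g : E -> R) e : (0 <= (Num.max (g e) 0)%:E)%E.
  by rewrite lee_fin max0_ge0.
have fin (g : E -> R) v : (\esum_(e in [set: E]) (Num.max (g e) 0)%:E < +oo)%E ->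
    \esum_(e in [set e | s e = v]) (Num.max (g e) 0)%:E \is a fin_num.
  move=> gfin; apply: esum_lty_fin_num => [e _|]; first exact: max0_ge0.
  apply: le_lt_trans gfin; rewrite esum_mkcond; apply: le_esum => e _.
  by case: ifP.
have eqfin (g : E -> R) : (\esum_(e in [set: E]) (Num.max (g e) 0)%:E < +oo)%E ->
  \esum_(v in [set: V])
    (fine (\esum_(e in [set e | s e = v]) (Num.max (g e) 0)%:E))%:E
  = \esum_(e in [set: E]) (Num.max (g e) 0)%:E.
  move=> gfin; rewrite (esum_fiber s)//; apply: eq_esum => v _.
  by rewrite fineK// fin.
rewrite (eq_rsum (fun v _ => rsumE [set e | s e = v] f)).
rewrite rsumB_ge0.
- by rewrite rsumE (eqfin f)// (eqfin (fun i => - f i)).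
- by move=> v _; apply/fine_ge0/esum_ge0 => e _; rewrite lee_fin max0_ge0.
- by move=> v _; apply/fine_ge0/esum_ge0 => e _; rewrite lee_fin max0_ge0.
- by rewrite (eqfin f).
- by rewrite (eqfin (fun i => - f i)).
Qed.

(** * Weighted l^2 spaces *)

Section weighted_l2.
Variables (R : realType) (V : choiceType) (q : V -> R).
Hypothesis q_ge0 : forall v, 0 <= q v.
Implicit Types f g : V -> R.

Lemma Hsp_mul_summable f g : Hsp q f -> Hsp q g ->
  summable [set: V] (EFin \o (fun v => q v * (f v * g v))).
Proof.
move=> Hf Hg.
apply: (@summable_le _ _ _ _ (fun v => q v * f v ^+ 2 + q v * g v ^+ 2)).
  move=> v _; rewrite normrM (ger0_norm (q_ge0 v)) -mulrDr ler_wpM2l//.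
  by rewrite ler_norml; apply/andP; split; nra.
under eq_esum do rewrite EFinD.
rewrite esumD ?lte_add_pinfty// => v _;
  by rewrite lee_fin mulr_ge0// sqr_ge0.
Qed.

(** Point masses are the test functions that give uniqueness of the adjoint in
    [condE_comp_adjoint]. *)
Lemma delta_Hsp w : Hsp q (fun v => (v == w)%:R).
Proof.
rewrite /Hsp /= (@esum_supp1 _ _ w) ?ltry//.
  by rewrite lee_fin mulr_ge0// sqr_ge0.
by move=> v /eqP/negPf ->; rewrite expr0n mulr0.
Qed.

Lemma Hinner_delta w f : Hinner q (fun v => (v == w)%:R) f = f w * q w.
Proof.
rewrite /Hinner (@rsum_supp1 _ _ w) ?eqxx ?mul1r// => v /eqP/negPf ->.
by rewrite !mul0r.
Qed.

End weighted_l2.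

(** The conditional expectation of [F] given [s] for the measure with weights [m], viewed as a
    function on [V]. It has this meaning when [q v] is the mass of the fiber over [v]. *)
Definition condE (R : realType) (E V : choiceType) (m : E -> R) (s : E -> V)
    (q : V -> R) (F : E -> R) : V -> R :=
  fun v => (q v)^-1 * rsum [set e | s e = v] (fun e => m e * F e).

(** * Conditional expectation along the fibers of a map *)

Section conditional_expectation.
Variables (R : realType) (E V : choiceType).
Variables (m : E -> R) (s : E -> V) (q : V -> R).
Hypothesis m_ge0 : forall e, 0 <= m e.
Hypothesis q_gt0 : forall v, 0 < q v.
Hypothesis mq : forall v, \esum_(e in [set e | s e = v]) (m e)%:E = (q v)%:E.
Implicit Types (F G : E -> R) (f g : V -> R).

Let q_ge0 v : 0 <= q v. Proof. exact: ltW. Qed.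

Let mF2_ge0 F e : 0 <= m e * F e ^+ 2.
Proof. by rewrite mulr_ge0// sqr_ge0. Qed.

(** Since [f \o s] is constant on each fiber of [s], summing fiber by fiber replaces [m] by its
    image [q]. This is the isometry of the embedding. *)
Lemma esum_comp f : \esum_(e in [set: E]) (m e * f (s e) ^+ 2)%:E =
  \esum_(v in [set: V]) (q v * f v ^+ 2)%:E.
Proof.
rewrite (esum_fiber s) => [|e]; last by rewrite lee_fin (mF2_ge0 (f \o s)).
apply: eq_esum => v _.
rewrite (@eq_esum _ _ _ _ (fun e => (f v ^+ 2 * m e)%:E)).
  by rewrite esumZ ?sqr_ge0// mq -EFinM mulrC.
by move=> e /= ->; rewrite mulrC.
Qed.

Lemma Hsp_comp f : Hsp q f -> Hsp m (f \o s).
Proof. by rewrite /Hsp /= esum_comp. Qed.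

Lemma Hnorm_comp f : Hnorm m (f \o s) = Hnorm q f.
Proof. by rewrite /Hnorm /= esum_comp. Qed.

Lemma fiber_weight_summable v :
  summable [set e | s e = v] (EFin \o m).
Proof. by rewrite summable_ge0// mq ltry. Qed.

Lemma fiber_sqr_summable F v : Hsp m F ->
  summable [set e | s e = v] (EFin \o (fun e => m e * F e ^+ 2)).
Proof.
move=> HF; apply: (@sub_summable _ _ _ [set: E]) => //.
by rewrite summable_ge0.
Qed.

(** Each fiber has finite mass [q v], so square-summability implies summability there, by the bound
    [|x| <= 1 + x^2]. *)
Lemma fiber_summable F v : Hsp m F ->
  summable [set e | s e = v] (EFin \o (fun e => m e * F e)).
Proof.
move=> /(@fiber_sqr_summable F v); rewrite summable_ge0// => HF.
apply: (@summable_le _ _ _ _ (fun e => m e + m e * F e ^+ 2)).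
  move=> e _; rewrite normrM (ger0_norm (m_ge0 e)) -[in leRHS](mulr1 (m e)).
  rewrite -mulrA mul1r -mulrDr ler_wpM2l//.
  by rewrite ler_norml; apply/andP; split; nra.
under eq_esum do rewrite EFinD.
by rewrite esumD ?lte_add_pinfty// ?mq ?ltry// => e _; rewrite lee_fin.
Qed.

Lemma condE_linear (a : R) F G : Hsp m F -> Hsp m G ->
  condE m s q (fun e => a * F e + G e) =
  (fun v => a * condE m s q F v + condE m s q G v).
Proof.
move=> HF HG; apply/funext => v; rewrite /condE.
rewrite (@eq_rsum _ _ _ _ (fun e => a * (m e * F e) + m e * G e)); last first.
  by move=> e _; ring.
rewrite rsumD ?rsumZ; first ring.
- exact/summableZ/fiber_summable.
- exact: fiber_summable.
Qed.

Lemma condE_ge0 F : (forall e, 0 <= F e) -> forall v, 0 <= condE m s q F v.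
Proof.
move=> F0 v; rewrite mulr_ge0 ?invr_ge0//.
by apply: rsum_ge0 => e _; rewrite mulr_ge0.
Qed.

Lemma condE_sqr_le F v : Hsp m F ->
  ((q v * condE m s q F v ^+ 2)%:E <=
   \esum_(e in [set e | s e = v]) (m e * F e ^+ 2)%:E)%E.
Proof.
move=> HF; set c := condE m s q F v; set D := [set e | s e = v].
have SF2 := fiber_sqr_summable v HF.
have SF := fiber_summable v HF.
have Sm := fiber_weight_summable v.
rewrite -[leRHS]fineK; last first.
  by move: SF2; rewrite summable_ge0//; exact: esum_lty_fin_num.
rewrite lee_fin -rsum_ge0E//.
(* Jensen's inequality, as the variance of [F] on the fiber is non-negative. *)
have : 0 <= rsum D (fun e => m e * (F e - c) ^+ 2).
  by apply: rsum_ge0 => e _; rewrite mulr_ge0// sqr_ge0.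
rewrite (@eq_rsum _ _ _ _ (fun e =>
    m e * F e ^+ 2 + ((- (c *+ 2)) * (m e * F e) + c ^+ 2 * m e))); last first.
  by move=> e _; ring.
rewrite (rsumD SF2 (summableD (summableZ _ SF) (summableZ _ Sm))).
rewrite (rsumD (summableZ _ SF) (summableZ _ Sm)).
rewrite !rsumZ [rsum D m]rsum_ge0E// mq /=.
(* By the definition of [c], the expanded variance becomes [A - 2 * q v * c^2 + q v * c^2], that is
   [A - q v * c^2]. *)
have -> : rsum D (fun e => m e * F e) = q v * c by rewrite mulVKf ?gt_eqF.
set A := rsum D _ => h; rewrite -subr_ge0.
by apply: le_trans h _; rewrite le_eqVlt; apply/orP; left; apply/eqP; ring.
Qed.

Lemma condE_esum_le F : Hsp m F ->
  (\esum_(v in [set: V]) (q v * condE m s q F v ^+ 2)%:E <=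
   \esum_(e in [set: E]) (m e * F e ^+ 2)%:E)%E.
Proof.
move=> HF; rewrite [leRHS](esum_fiber s); last by move=> e; rewrite lee_fin.
by apply: le_esum => v _; exact: condE_sqr_le.
Qed.

Lemma condE_Hsp F : Hsp m F -> Hsp q (condE m s q F).
Proof. by move=> HF; exact: le_lt_trans (condE_esum_le HF) HF. Qed.

Lemma condE_Hnorm_le F : Hsp m F -> Hnorm q (condE m s q F) <= Hnorm m F.
Proof.
move=> HF; rewrite ler_wsqrtr// fine_le ?condE_esum_le//.
- apply: esum_lty_fin_num; last exact: condE_Hsp.
  by move=> v _; rewrite mulr_ge0// sqr_ge0.
- exact: esum_lty_fin_num.
Qed.

(** On the fiber over [v] the factor [g (s e)] is the constant [g v] and can be taken out of the
    fiber sum, while the weight [q v] cancels the normalisation in [condE]. *)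
Lemma Hinner_condE F g : Hsp m F -> Hsp q g ->
  Hinner q (condE m s q F) g = rsum [set: E] (fun e => m e * (F e * g (s e))).
Proof.
move=> HF Hg; rewrite (rsum_fiber s); last exact: Hsp_mul_summable (Hsp_comp Hg).
apply: eq_rsum => v _.
rewrite (@eq_rsum _ _ _ _ (fun e => g v * (m e * F e))); last first.
  by move=> e /= ->; ring.
by rewrite rsumZ /condE; field; rewrite gt_eqF.
Qed.

End conditional_expectation.

(** * Operators between the two marginals of a measure *)

Section two_marginals.
Variables (R : realType) (E V W : choiceType) (m : E -> R).
Variables (s : E -> V) (t : E -> W) (q : V -> R) (r : W -> R).
Hypothesis m_ge0 : forall e, 0 <= m e.
Hypothesis q_gt0 : forall v, 0 < q v.
Hypothesis r_gt0 : forall w, 0 < r w.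
Hypothesis mq : forall v, \esum_(e in [set e | s e = v]) (m e)%:E = (q v)%:E.
Hypothesis mr : forall w, \esum_(e in [set e | t e = w]) (m e)%:E = (r w)%:E.

(** The setting is symmetric: with [s] the source and [t] the range, [C] is the operator T_Q;
    exchanging the two maps and their weights yields T_P. *)
Let C (f : V -> R) := condE m t r (f \o s).

Lemma condE_comp_linear_op : linear_op q r C.
Proof.
split => [f Hf|a f g Hf Hg].
  exact/(condE_Hsp m_ge0 r_gt0 mr)/(Hsp_comp m_ge0 mq).
exact: (condE_linear m_ge0 mr a (Hsp_comp m_ge0 mq Hf) (Hsp_comp m_ge0 mq Hg)).
Qed.

Lemma condE_comp_positive_op : positive_op q C.
Proof. by move=> f _ f0 w; apply: condE_ge0 => // e; exact: f0. Qed.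

Lemma condE_comp_contractive_op : contractive_op q r C.
Proof.
move=> f Hf; rewrite -(Hnorm_comp m_ge0 mq).
exact/(condE_Hnorm_le m_ge0 r_gt0 mr)/(Hsp_comp m_ge0 mq).
Qed.

Lemma condE_comp_adjoint : is_adjoint q r C (fun g => condE m s q (g \o t)).
Proof.
move=> g Hg.
have adj f : Hsp q f -> Hinner r (C f) g = Hinner q f (condE m s q (g \o t)).
  move=> Hf; have Hfs := Hsp_comp m_ge0 mq Hf.
  have Hgt := Hsp_comp m_ge0 mr Hg.
  have -> : Hinner q f (condE m s q (g \o t)) = Hinner q (condE m s q (g \o t)) f.
    by apply: eq_rsum => v _; rewrite [f v * _]mulrC.
  rewrite (Hinner_condE m_ge0 r_gt0 mr)// (Hinner_condE m_ge0 q_gt0 mq)//.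
  by apply: eq_rsum => e _ /=; rewrite [f _ * _]mulrC.
have q_ge0 v : 0 <= q v by exact: ltW.
move=> h; split => [[_ hP]|->].
  (* Uniqueness: pairing with the point mass at [v] recovers the value at [v] times [q v], which is
     cancelled because [q v] is positive. *)
  apply/funext => v; apply: (mulIf (lt0r_neq0 (q_gt0 v))).
  by rewrite -!Hinner_delta -hP ?adj//; exact: delta_Hsp.
split => //; exact/(condE_Hsp m_ge0 q_gt0 mq)/(Hsp_comp m_ge0 mr).
Qed.

End two_marginals.

(** * Edge masses on a generalized Bratteli diagram *)

Lemma incidence_neq0 (B : graded_graph) n (v : vtx B n.+1) (w : vtx B n) :
  finite_set (edges w v) -> incidence v w != 0%N <-> edges w v !=set0.
Proof.
move=> fin; rewrite /incidence cardfs_eq0; split=> [|[e we]].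
  by move=> /fset0Pn[e]; rewrite in_fset_set// inE => we; exists e.
by apply/fset0Pn; exists e; rewrite in_fset_set// inE.
Qed.

Section Bratteli.
Variables (R : realType) (B : graded_graph) (hB : generalized_Bratteli B).

(** A row of the incidence matrix has finitely many non-zero entries, and each of them counts a
    finite set of parallel edges. *)
Lemma finite_range_fiber n (u : vtx B n.+1) :
  finite_set [set e : edge B n | rng e = u].
Proof.
apply: (@sub_finite_set _ _
    (\bigcup_(w in [set w | incidence u w != 0%N]) edges w u)).
  move=> e eu; exists (src e) => //=.
  by apply/incidence_neq0; [exact: finite_edges|exists e].
apply: bigcup_finite; first exact: finite_rows.
by move=> w _; exact: finite_edges.
Qed.

Lemma range_fiber_nonempty n (u : vtx B n.+1) :
  [set e : edge B n | rng e = u] !=set0.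
Proof.
have [w /incidence_neq0[|e [_ eu]]] := nonzero_row hB u; last by exists e.
exact: finite_edges.
Qed.

Lemma fsum_edges n (u : vtx B n.+1) (F : edge B n -> R) :
  \sum_(v \in [set: vtx B n]) \sum_(e \in edges v u) F e =
  \sum_(e \in [set e | rng e = u]) F e.
Proof.
set A := [set e | rng e = u]; have finA : finite_set A := finite_range_fiber u.
(* [D] consists of the vertices joined to [u]; for any other [v] the inner sum is empty, so the
   outer sum becomes finite. *)
pose D := (@src B n) @` A; have finD : finite_set D by exact: finite_image.
rewrite -(@fsbig_widen _ _ _ _ D)//; last first.
  move=> v [_ /= vD]; rewrite fsbig1// => e [ev eu]; case: vD.
  by exists e.
(* Turning the condition [src e = v] into a conditional summand makes the inner index set
   independent of [v]. After the exchange only [v = src e] contributes. *)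
transitivity (\sum_(v \in D) \sum_(e \in A) if src e == v then F e else 0).
  apply: eq_fsbigr => v _; rewrite (_ : edges v u = A `&` [set e | src e = v]).
    rewrite fsbig_mkcondr; apply: eq_fsbigr => e _.
    by congr (if _ then _ else _); apply/idP/eqP; rewrite inE.
  by apply/seteqP; split=> e [].
rewrite exchange_fsbig//; apply: eq_fsbigr => e /[!inE] eA.
rewrite -(@fsbig_widen _ _ _ _ [set src e])//= ?fsbig_set1 ?eqxx//.
  by move=> _ ->; exists e.
by move=> v [_ /= /eqP/negPf ve]; rewrite eq_sym ve.
Qed.

Variables (q0 : vtx B 0 -> R) (hq0 : forall v, 0 < q0 v).
Variables (P : forall n, vtx B n -> edge B n -> R) (hP : Markov P).

Definition edge_mass n (e : edge B n) : R := qvec P q0 (src e) * P (src e) e.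

(** The recursion for [qvec], regrouped by edges. It is kept as a finite sum because the positivity
    of the masses is derived from it; [edge_mass_rng] restates it as an [esum]. *)
Lemma qvecS n (u : vtx B n.+1) :
  qvec P q0 u = \sum_(e \in [set e : edge B n | rng e = u]) edge_mass e.
Proof.
rewrite -fsum_edges; apply: eq_fsbigr => v _; rewrite /phat mulr_fsumr.
by apply: eq_fsbigr => e; rewrite inE => -[<- _].
Qed.

Lemma Markov_src_gt0 n (e : edge B n) : 0 < P (src e) e.
Proof. exact/(Markov_gt0 hP). Qed.

(** By induction on the level: no row is zero, so some edge ends at [u], and its mass is positive
    because its source has positive weight. *)
Lemma qvec_gt0 n (v : vtx B n) : 0 < qvec P q0 v.
Proof.
elim: n v => [//|n IH] u; rewrite qvecS.
have mass_gt0 (e : edge B n) : 0 < edge_mass e.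
  by rewrite mulr_gt0 ?Markov_src_gt0.
have [e eu] := range_fiber_nonempty u.
rewrite (fsbigD1 e)//=; last exact: finite_range_fiber.
by rewrite ltr_wpDr// fsumr_ge0// => i _; exact: ltW.
Qed.

Lemma edge_mass_ge0 n (e : edge B n) : 0 <= edge_mass e.
Proof. by rewrite ltW// mulr_gt0 ?Markov_src_gt0 ?qvec_gt0. Qed.

Lemma edge_mass_src n (v : vtx B n) :
  \esum_(e in [set e : edge B n | src e = v]) (edge_mass e)%:E =
  (qvec P q0 v)%:E.
Proof.
rewrite (@eq_esum _ _ _ _ (fun e => (qvec P q0 v * P v e)%:E)); last first.
  by move=> e /= <-.
rewrite esumZ ?(Markov_sum1 hP) ?mule1 ?ltW ?qvec_gt0// => e.
exact: (Markov_ge0 hP).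
Qed.

Lemma edge_mass_rng n (u : vtx B n.+1) :
  \esum_(e in [set e : edge B n | rng e = u]) (edge_mass e)%:E =
  (qvec P q0 u)%:E.
Proof.
have fin := finite_range_fiber u.
rewrite esum_fset//; last by move=> e _; rewrite lee_fin edge_mass_ge0.
by rewrite qvecS !fsbig_finite//= sumEFin.
Qed.

(** In the mass of an edge from [v] the factor [qvec P q0 v] is constant on the source fiber and
    cancels the normalisation. *)
Lemma TP_condE n : @TP R B P n =
  (fun f => condE (@edge_mass n) (@src B n) (qvec P q0 (n := n))
    (f \o @rng B n)).
Proof.
apply/funext => f; apply/funext => v; rewrite /TP /condE -rsumZ.
apply: eq_rsum => e /= ev; rewrite /edge_mass ev.
by field; rewrite gt_eqF ?qvec_gt0.
Qed.

(** [Q] need not be proportional to the edge masses edge by edge. Since [g \o src] is constant on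
    parallel edges, only the sums prescribed by [dual_kernel] matter. *)
Lemma TQ_condE (Q : forall n, vtx B n.+1 -> edge B n -> R) n :
  dual_kernel P q0 Q -> @TQ R B Q n =
  (fun g => condE (@edge_mass n) (@rng B n) (qvec P q0 (n := n.+1))
    (g \o @src B n)).
Proof.
move=> hQ; apply/funext => g; apply/funext => u; rewrite /TQ /condE.
rewrite rsum_finite; last exact: finite_range_fiber.
rewrite -!fsum_edges mulr_fsumr; apply: eq_fsbigr => v _.
transitivity ((\sum_(e \in edges v u) Q n u e) * g v).
  by rewrite mulr_fsuml; apply: eq_fsbigr => e; rewrite inE => -[<- _].
rewrite hQ /qhat /phat.
transitivity ((qvec P q0 u)^-1 * (qvec P q0 v * g v *
    \sum_(e \in edges v u) P v e)); first by ring.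
congr (_ * _); rewrite mulr_fsumr; apply: eq_fsbigr => e; rewrite inE => -[<- _].
by rewrite /edge_mass /=; ring.
Qed.

(** The function [f \o rng] is square-summable for the edge masses, hence summable on each source
    fiber; dividing by the weight of [v] gives the series in [TP]. *)
Lemma Hsp_TP_converges n (f : vtx B n.+1 -> R) :
  Hsp (qvec P q0 (n := n.+1)) f -> TP_converges P f.
Proof.
move=> Hf v.
have := fiber_summable (@edge_mass_ge0 n) (@edge_mass_src n) v
  (Hsp_comp (@edge_mass_ge0 n) (@edge_mass_rng n) Hf).
move=> /(@summableZ _ _ _ (qvec P q0 v)^-1); rewrite /summable.
congr (_ < _)%E; apply: eq_esum => e /= ev; rewrite /edge_mass ev.
by rewrite -mulrA mulKf// gt_eqF ?qvec_gt0.
Qed.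

End Bratteli.

Theorem proposition3p19 (R : realType) (B : graded_graph)
  (hB : generalized_Bratteli B)
  (q0 : vtx B 0 -> R) (hq0 : forall v, 0 < q0 v)
  (P : forall n, vtx B n -> edge B n -> R) (hP : Markov P)
  (Q : forall n, vtx B n.+1 -> edge B n -> R) (hQ : dual_kernel P q0 Q) :
  (forall n : nat,
     let q := @qvec R B P q0 n in
     let q' := @qvec R B P q0 n.+1 in
     let T_P := @TP R B P n in
     let T_Q := @TQ R B Q n in
     [/\ (forall f, Hsp q' f -> TP_converges P f),
         linear_op q' q T_P /\ linear_op q q' T_Q,
         positive_op q' T_P /\ positive_op q T_Q
       & contractive_op q' q T_P /\ contractive_op q q' T_Q])
  /\
  (forall n : nat,
     let q := @qvec R B P q0 n in
     let q' := @qvec R B P q0 n.+1 in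
     let T_P := @TP R B P n in
     let T_Q := @TQ R B Q n in
     is_adjoint q' q T_P T_Q /\ is_adjoint q q' T_Q T_P).
Proof.
split=> n /=; rewrite (TP_condE hB hq0 hP n) (TQ_condE hB n hQ).
all: have m0 := @edge_mass_ge0 R B hB q0 hq0 P hP n.
all: have q_gt0 := @qvec_gt0 R B hB q0 hq0 P hP n.
all: have q'_gt0 := @qvec_gt0 R B hB q0 hq0 P hP n.+1.
all: have ms := @edge_mass_src R B hB q0 hq0 P hP n.
all: have mr := @edge_mass_rng R B hB q0 hq0 P hP n.
  split; first by move=> f; exact: (Hsp_TP_converges hB hq0 hP).
  (* In each pair the two halves are instances of one lemma with source and range exchanged. *)
  - by split; exact: condE_comp_linear_op.
  - by split; exact: condE_comp_positive_op.
  - by split; exact: condE_comp_contractive_op.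
by split; exact: condE_comp_adjoint.
Qed.
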